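(* Let $G=\langle\delta\rangle\times\langle\varepsilon\rangle$ be the direct product of cyclic groups of orders $m$ and $n$, respectively, and let $\alpha=\delta^a\varepsilon^{a'}$ and $\beta=\delta^b\varepsilon^{b'}$ be elements generating $G$. Then the interchange laws belonging to $\Sigma(G;\alpha,\beta)$ form a basis for $\Sigma(G;\alpha,\beta)$ iff $-1+\omega^a\xi^{a'}+\omega^b\xi^{b'}\neq 0$ for every complex $m$-th root of unity $\omega$ and every complex $n$-th root of unity $\xi$.
   Context: For a multiplicative abelian group $G$ generated by $\alpha$ and $\beta$, $\Sigma(G;\alpha,\beta)$ is the set of groupoid identities satisfied in the integral group ring $\mathbb{Z}[G]$ when the binary operation is $xy=\alpha x+\beta y$. A groupoid term is linear if no variable occurs in it more than once; if $p$ is a linear term and $q$ is obtained from $p$ by swapping two of its variables, then $p=q$ is an interchange law. A basis is a set of identities whose equational consequences are exactly $\Sigma(G;\alpha,\beta)$. *)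

(* Defs.v *)
From HB Require Import structures.
From mathcomp Require Import all_boot all_order all_algebra all_fingroup all_field.
Set Implicit Arguments. Unset Strict Implicit. Unset Printing Implicit Defensive.
Import GRing.Theory Num.Theory.

Inductive term : Type := Var of nat | App of term & term.

Fixpoint vars (t : term) : seq nat :=
  match t with Var x => [:: x] | App s u => vars s ++ vars u end.

Definition linear_term (t : term) : Prop := uniq (vars t).

Fixpoint subst (s : nat -> term) (t : term) : term :=
  match t with Var x => s x | App t1 t2 => App (subst s t1) (subst s t2) end.

Definition swapv (x y : nat) (z : nat) : nat :=
  if z == x then y else if z == y then x else z.
Definition swap_term (x y : nat) (t : term) : term := subst (fun z => Var (swapv x y z)) t.

Definition identity := (term * term)%type.

Definition interchange_law (e : identity) : Prop :=
  exists x y, [/\ linear_term e.1, x \in vars e.1, y \in vars e.1, x != y &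
                  e.2 = swap_term x y e.1].

Inductive derivable (B : identity -> Prop) : term -> term -> Prop :=
| der_ax p q : B (p, q) -> derivable B p q
| der_refl p : derivable B p p
| der_sym p q : derivable B p q -> derivable B q p
| der_trans p q r : derivable B p q -> derivable B q r -> derivable B p r
| der_subst s p q : derivable B p q -> derivable B (subst s p) (subst s q)
| der_congr p p' q q' : derivable B p p' -> derivable B q q' ->
                        derivable B (App p q) (App p' q').

Local Open Scope ring_scope.
Definition grring (gT : finGroupType) := {ffun gT -> int}.

Definition gr_add (gT : finGroupType) (f g : grring gT) : grring gT :=
  [ffun h => f h + g h].
Definition gr_mul (gT : finGroupType) (f g : grring gT) : grring gT :=
  [ffun h => \sum_(k : gT) f k * g (k^-1 * h)%g].
Definition gr_of (gT : finGroupType) (g : gT) : grring gT :=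
  [ffun h => (((h == g)%g : bool) : nat)%:Z].

Definition gop (gT : finGroupType) (alpha beta : gT) (x y : grring gT) : grring gT :=
  gr_add (gr_mul (gr_of alpha) x) (gr_mul (gr_of beta) y).

Fixpoint geval (gT : finGroupType) (alpha beta : gT) (v : nat -> grring gT)
    (t : term) : grring gT :=
  match t with
  | Var x => v x
  | App t1 t2 => gop alpha beta (geval alpha beta v t1) (geval alpha beta v t2)
  end.

Definition Sigma (gT : finGroupType) (alpha beta : gT) (e : identity) : Prop :=
  forall v : nat -> grring gT, geval alpha beta v e.1 = geval alpha beta v e.2.

Definition is_basis (B : identity -> Prop) (S : identity -> Prop) : Prop :=
  forall p q, derivable B p q <-> S (p, q).

(* Main.v *)
Require Import Defs.
From HB Require Import structures.
From mathcomp Require Import all_boot all_order all_algebra all_fingroup all_field.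
From mathcomp Require Import cyclic zify ring.
Import GRing.Theory Num.Theory.

Set Implicit Arguments.
Unset Strict Implicit.

(* The leaves of a term carry the positions alpha^i beta^j read off their paths,
   and an identity belongs to Sigma iff both sides put each variable at the same
   multiset of positions. Every node but the root is a child of an interior node,
   so the interior position counts nu of the two sides of an identity of Sigma
   satisfy (alpha + beta - 1) (nu(p) - nu(q)) = 0 in Z[G].

   Interchange laws of Sigma preserve nu; conversely two terms with the same leaf
   data and the same nu are connected by exchanging disjoint subterms at equal
   positions, building one side into the other from the root downwards. Since
   every element of Z[G] is a difference nu(p) - nu(q), the interchange laws form a
   basis iff alpha + beta - 1 is not a zero divisor of Z[G], which by Fourier
   inversion means that no character of G sends it to 0. *)

(** * Substitutions and transpositions of variables *)

Definition upd (s : nat -> term) (x : nat) (u : term) (z : nat) : term :=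
  if z == x then u else s z.

Definition label (t : term) : option nat := if t is Var x then Some x else None.

Lemma eq_subst s s' t :
  (forall x, x \in vars t -> s x = s' x) -> subst s t = subst s' t.
Proof.
elim: t => [x|p IHp q IHq] /= eqs; first by apply: eqs; rewrite inE.
by rewrite IHp ?IHq // => x xp; apply: eqs; rewrite mem_cat xp ?orbT.
Qed.

Lemma subst_subst s r t : subst s (subst r t) = subst (fun x => subst s (r x)) t.
Proof. by elim: t => //= p -> q ->. Qed.

Lemma vars_subst s t : vars (subst s t) = flatten [seq vars (s x) | x <- vars t].
Proof.
by elim: t => [x|p IHp q IHq] /=; rewrite ?cats0 // IHp IHq map_cat flatten_cat.
Qed.

Lemma perm_cat_mid (T : eqType) (s a b c d : seq T) :
  perm_eq (a ++ s ++ b) (c ++ s ++ d) = perm_eq (a ++ b) (c ++ d).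
Proof. by rewrite perm_catCA perm_sym perm_catCA perm_cat2l perm_sym. Qed.

Lemma swapvK x y : involutive (swapv x y).
Proof.
move=> z; rewrite /swapv; case: (eqVneq z x) => [->|zx].
  by rewrite eqxx; case: eqP.
by case: (eqVneq z y) => [->|zy]; rewrite ?eqxx // (negPf zx) (negPf zy).
Qed.

(** * Nodes of a term and their positions in the group *)

Section Nodes.

Variables (gT : finGroupType) (alpha beta : gT).
Local Open Scope group_scope.

Local Notation laws := (fun e => interchange_law e /\ Sigma alpha beta e).

(* A node carries the product of the generators read along the path from the
   root, started at [g]; its label is [None] when it is interior. *)
Fixpoint nodes (g : gT) (t : term) : seq (gT * option nat) :=
  match t with
  | Var x => [:: (g, Some x)]
  | App p q => (g, None) :: nodes (g * alpha) p ++ nodes (g * beta) q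
  end.

Lemma nodes_subst s g t :
  nodes g (subst s t) =
  flatten [seq (if n.2 is Some x then nodes n.1 (s x) else [:: n]) | n <- nodes g t].
Proof.
elim: t g => [x|p IHp q IHq] g /=; first by rewrite cats0.
by rewrite IHp IHq map_cat flatten_cat.
Qed.

Lemma nodes_mulg g h t : nodes (g * h) t = [seq (g * n.1, n.2) | n <- nodes h t].
Proof. by elim: t h => //= p IHp q IHq h; rewrite map_cat -!mulgA IHp IHq. Qed.

Lemma perm_nodes g p q :
  perm_eq (nodes 1 p) (nodes 1 q) -> perm_eq (nodes g p) (nodes g q).
Proof. by rewrite -(mulg1 g) !nodes_mulg; apply: perm_map. Qed.

Lemma gopE (x y : grring gT) k :
  gop alpha beta x y k = (x (alpha^-1 * k)%g + y (beta^-1 * k)%g)%R.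
Proof.
rewrite /gop /gr_add /gr_mul !ffunE.
by congr (_ + _)%R; [rewrite (bigD1 alpha) | rewrite (bigD1 beta)];
  rewrite //= ffunE eqxx mul1r big1 ?addr0 // => i /negPf ni; rewrite ffunE ni mul0r.
Qed.

(** Each leaf contributes a translate of its value. The start [g] is kept general because descending
    into a child multiplies it by a generator. *)
Lemma geval_nodes v g t k :
  geval alpha beta v t (g^-1 * k) =
  (\sum_(n <- nodes g t) if n.2 is Some x then v x (n.1^-1 * k)%g else 0)%R.
Proof.
elim: t g => [x|p IHp q IHq] g; first by rewrite /= big_seq1.
by rewrite [LHS]gopE /= big_cons add0r big_cat /= !mulgA -!invMg IHp IHq.
Qed.

Lemma perm_nodes_Sigma p q :
  perm_eq (nodes 1 p) (nodes 1 q) -> Sigma alpha beta (p, q).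
Proof.
move=> pq v; apply/ffunP => k; rewrite -[k]mul1g -[X in X * k]invg1.
by rewrite !geval_nodes; apply: perm_big.
Qed.

Lemma sumr_count (T : Type) (P : pred T) (s : seq T) :
  (\sum_(n <- s) (P n : nat)%:Z = (count P s)%:Z)%R.
Proof. by elim: s => [|n s IHs]; rewrite ?big_nil // big_cons IHs. Qed.

Definition leaf_at (k : gT) : pred (gT * option nat) :=
  fun n => (n.1 == k) && (n.2 != None).

(** Sending [x] to the unit and the other variables to 0 makes the value of a term count the
    occurrences of [x] by position. *)
Lemma count_var g t k x :
  (count_mem (k, Some x) (nodes g t))%:Z%R =
  geval alpha beta
    (fun y => if y == x then gr_of (1 : gT) else [ffun=> 0%R]) t (g^-1 * k).
Proof.
rewrite geval_nodes -sumr_count; apply: eq_bigr => -[h [y|]] _ /=; last first.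
  by rewrite xpair_eqE andbF.
rewrite xpair_eqE (inj_eq (@Some_inj _)).
case: (eqVneq y x) => _; rewrite ffunE ?andbF // andbT.
by rewrite -eq_mulVg1.
Qed.

Lemma count_leaf g t k :
  (count (leaf_at k) (nodes g t))%:Z%R =
  geval alpha beta (fun=> gr_of (1 : gT)) t (g^-1 * k).
Proof.
rewrite geval_nodes -sumr_count; apply: eq_bigr => -[h [y|]] _ /=; last first.
  by rewrite /leaf_at andbF.
by rewrite /leaf_at andbT ffunE -eq_mulVg1.
Qed.

(** Double counting of the nodes at [k]: each is a leaf or interior, and each is the root, the left
    child of an interior node at [k * alpha^-1], or the right child of one at [k * beta^-1]. *)
Lemma count_nodes g t k :
  (count (leaf_at k) (nodes g t) + count_mem (k, None) (nodes g t) =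
   (k == g) + count_mem ((k * alpha^-1)%g, None) (nodes g t)
   + count_mem ((k * beta^-1)%g, None) (nodes g t))%N.
Proof.
elim: t g => [x|p IHp q IHq] g /=.
  by rewrite /leaf_at /= !xpair_eqE !andbF andbT eq_sym.
rewrite !count_cat /leaf_at /= !xpair_eqE !andbT andbF add0n.
have Ea : (g == k * alpha^-1) = (k == g * alpha).
  by rewrite -(inj_eq (mulIg alpha)) mulgKV eq_sym.
have Eb : (g == k * beta^-1) = (k == g * beta).
  by rewrite -(inj_eq (mulIg beta)) mulgKV eq_sym.
rewrite Ea Eb [g == k]eq_sym.
move: (IHp (g * alpha)) (IHq (g * beta)); rewrite /leaf_at.
set x1 := count _ _; set x2 := count _ _; set x3 := count _ _; set x4 := count _ _.
set y1 := count _ _; set y2 := count _ _; set y3 := count _ _; set y4 := count _ _.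
lia.
Qed.

Lemma Sigma_count_var p q k x : Sigma alpha beta (p, q) ->
  count_mem (k, Some x) (nodes 1 p) = count_mem (k, Some x) (nodes 1 q).
Proof. by move=> pq; apply/eqP; rewrite -eqz_nat !count_var; have /= -> := pq _. Qed.

Lemma Sigma_count_leaf p q k : Sigma alpha beta (p, q) ->
  count (leaf_at k) (nodes 1 p) = count (leaf_at k) (nodes 1 q).
Proof. by move=> pq; apply/eqP; rewrite -eqz_nat !count_leaf; have /= -> := pq _. Qed.

(** The multiset of nodes is an invariant of derivations: a law keeps the leaf counts because it
    lies in [Sigma], and the interior ones because a swap only renames leaves. *)
Lemma derivable_perm p q : derivable laws p q -> perm_eq (nodes 1 p) (nodes 1 q).
Proof.
elim=> {p q} [p q [[x [y [_ _ _ _ /= ->]]] SgE]|p|p q _|p q r _ pq _ qr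
             |s p q _ pq|p p' q q' _ pp' _ qq'] //.
- apply/allP => -[k [z|]] _ /=; apply/eqP.
    exact: Sigma_count_var.
  rewrite /swap_term nodes_subst; elim: (nodes 1 p) => //= -[h [z|]] s IHs /=.
    by rewrite IHs !xpair_eqE !andbF.
  by rewrite IHs.
- by rewrite perm_sym.
- exact: perm_trans pq qr.
- by rewrite !nodes_subst; apply/perm_flatten/perm_map.
- by rewrite /= perm_cons; apply: perm_cat; apply: perm_nodes.
Qed.

(** * Positions of variables in linear terms *)

Fixpoint pos (g : gT) (t : term) (x : nat) : gT :=
  match t with
  | Var _ => g
  | App p q => if x \in vars p then pos (g * alpha) p x else pos (g * beta) q x
  end.

Lemma geval_linear v g t k : linear_term t ->
  geval alpha beta v t (g^-1 * k) =
  (\sum_(x <- vars t) v x ((pos g t x)^-1 * k)%g)%R.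
Proof.
rewrite /linear_term.
elim: t g => [x|p IHp q IHq] g; first by rewrite /= big_seq1.
rewrite [LHS]gopE /= cat_uniq => /and3P[up /hasPn npq uq].
rewrite big_cat /= !mulgA -!invMg IHp // IHq //; congr (_ + _)%R.
  by apply: eq_big_seq => x xp; rewrite xp.
by apply: eq_big_seq => x /npq /negPf ->.
Qed.

Lemma pos_subst s g t w x :
    linear_term (subst s t) -> w \in vars t -> x \in vars (s w) ->
  pos g (subst s t) x = pos (pos g t w) (s w) x.
Proof.
rewrite /linear_term => + + xw.
elim: t g => [y|p IHp q IHq] g /=; first by rewrite inE => _ /eqP <-.
rewrite cat_uniq mem_cat => /and3P[up /hasPn npq uq].
have in_s r : w \in vars r -> x \in vars (subst s r).
  by move=> wr; rewrite vars_subst; apply/flatten_mapP; exists w.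
case: (boolP (w \in vars p)) => wp /=; first by rewrite in_s // => _; apply: IHp.
by move=> wq; rewrite (negPf (npq _ (in_s _ wq))); apply: IHq.
Qed.

Lemma geval_subst v s t :
  geval alpha beta v (subst s t) = geval alpha beta (fun x => geval alpha beta v (s x)) t.
Proof. by elim: t => //= p -> q ->. Qed.

(** The transposition permutes the leaves and preserves their positions, so reindexing the sum of
    [geval_linear] along it turns one value into the other. *)
Lemma swap_Sigma t x y : linear_term t -> x \in vars t -> y \in vars t ->
  pos 1 t x = pos 1 t y -> Sigma alpha beta (t, swap_term x y t).
Proof.
move=> lt xt yt pxy v /=; rewrite /swap_term geval_subst; apply/ffunP => k.
rewrite -[k]mul1g -[X in X * k]invg1 !geval_linear //=.
have swap_in z : z \in vars t -> swapv x y z \in vars t.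
  by rewrite /swapv; do 2![case: eqP => // _].
have inj_swap := can_inj (swapvK x y).
have pm : perm_eq (map (swapv x y) (vars t)) (vars t).
  apply: uniq_perm; rewrite ?map_inj_uniq // => z; apply/mapP/idP => [[w wt ->]|zt].
    exact: swap_in.
  by exists (swapv x y z); rewrite ?swapvK ?swap_in.
rewrite -(perm_big _ pm) big_map /=; apply: eq_bigr => z _.
suff -> : pos 1 t (swapv x y z) = pos 1 t z by [].
by rewrite /swapv; case: (eqVneq z x) => [->//|_]; case: (eqVneq z y) => [->|].
Qed.

(** * Exchanging disjoint subterms by interchange laws *)

Lemma derivable_swap s t x y : linear_term t -> x \in vars t -> y \in vars t ->
    x != y -> pos 1 t x = pos 1 t y ->
  derivable laws (subst s t) (subst (upd (upd s x (s y)) y (s x)) t).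
Proof.
move=> lt xt yt nxy pxy.
have -> : subst (upd (upd s x (s y)) y (s x)) t = subst s (swap_term x y t).
  rewrite /swap_term subst_subst; apply: eq_subst => z _ /=.
  rewrite /upd /swapv; case: (eqVneq z y) => [->|_]; last by case: eqP.
  by rewrite eq_sym (negPf nxy).
apply/der_subst/der_ax; split; last exact: swap_Sigma.
by exists x, y; split.
Qed.

(** Refines the context [t] by one step: the leaf [z] becomes a product whose left child keeps the
    name [z] and whose right child is a fresh [y]. This opens the children of [s z] to swaps. *)
Lemma split_leaf t z : linear_term t -> z \in vars t ->
  exists t' y,
    [/\ linear_term t', y \notin vars t & vars t' =i y :: vars t] /\
    [/\ {in vars t, forall x, x != z -> pos 1 t' x = pos 1 t x},
        pos 1 t' z = pos 1 t z * alpha, pos 1 t' y = pos 1 t z * beta &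
        forall s u v, s z = App u v -> subst s t = subst (upd (upd s z u) y v) t'].
Proof.
move=> lt zt; pose y := (\max_(x <- vars t) x).+1.
have yt : y \notin vars t.
  by apply/negP => yt; have := @leq_bigmax_seq _ _ xpredT id _ yt isT; rewrite ltnn.
have nyz : (y == z) = false by apply: contraNF yt => /eqP ->.
pose r := upd Var z (App (Var z) (Var y)).
have pv : perm_eq (vars (subst r t)) (y :: vars t).
  rewrite vars_subst.
  have /(perm_map (fun x => vars (r x)))/perm_flatten/perm_trans := perm_to_rem zt.
  apply; rewrite /= {1}/r /upd eqxx /= perm_sym.
  apply: (perm_trans _ (permEl (perm_catCA [:: y] [:: z] _))).
  rewrite /= perm_cons.
  apply: perm_trans (perm_to_rem zt) _; rewrite perm_cons.
  suff -> : flatten [seq vars (r x) | x <- rem z (vars t)] = rem z (vars t) by [].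
  have : z \notin rem z (vars t) by rewrite mem_rem_uniqF.
  elim: (rem z _) => //= x l IHl; rewrite inE negb_or => /andP[zx /IHl ->].
  by rewrite /r /upd eq_sym (negPf zx).
have lr : linear_term (subst r t) by rewrite /linear_term (perm_uniq pv) /= yt.
have rz : r z = App (Var z) (Var y) by rewrite /r /upd eqxx.
exists (subst r t), y; split; first by split=> //; apply: perm_mem.
split.
- move=> x xt nxz; rewrite (@pos_subst r 1 t x) //.
    by rewrite /r /upd (negPf nxz).
  by rewrite /r /upd (negPf nxz) inE.
- by rewrite (@pos_subst r 1 t z) ?rz //= ?inE ?eqxx.
- by rewrite (@pos_subst r 1 t z) ?rz //= ?inE ?nyz ?eqxx ?orbT.
- move=> s u v sz; rewrite subst_subst; apply: eq_subst => x xt.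
  rewrite /r /upd; case: (eqVneq x z) => [->|nxz] /=.
    by rewrite eqxx eq_sym nyz eqxx.
  by rewrite (negPf nxz); case: eqP xt yt => // -> ->.
Qed.

(** Brings a node of [s z] that has the position of [x] to the place of [x]. Induction on [s z]: at
    its root, exchanging [x] and [z] suffices; otherwise [z] is split and the search continues in a
    child, still disjoint from [x]. *)
Lemma expose (l : option nat) s t x z : linear_term t ->
    x \in vars t -> z \in vars t -> x != z ->
    (pos 1 t x, l) \in nodes (pos 1 t z) (s z) ->
  exists u w,
    [/\ label u = l,
        derivable laws (subst s t) (subst (upd (upd s x u) z w) t) &
        perm_eq (nodes (pos 1 t x) u ++ nodes (pos 1 t z) w)
                (nodes (pos 1 t x) (s x) ++ nodes (pos 1 t z) (s z))].
Proof.
move sz: (s z) => v; elim: v s t z sz => [b|v1 IH1 v2 IH2] s t z sz lt xt zt nxz.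
  rewrite inE xpair_eqE => /andP[/eqP pxz /eqP ->].
  exists (s z), (s x); split; first by rewrite sz.
    exact: derivable_swap.
  by rewrite pxz sz perm_catC.
rewrite /= inE xpair_eqE => /orP[/andP[/eqP pxz /eqP ->]|].
  exists (s z), (s x); split; first by rewrite sz.
    exact: derivable_swap.
  by rewrite pxz sz perm_catC.
have [t' [y [[lt' yt vt'] [pt' pz py st]]]] := split_leaf lt zt.
have nyz : (y == z) = false by apply: contraNF yt => /eqP ->.
have nzy : (z == y) = false by rewrite eq_sym.
have nyx : (y == x) = false by apply: contraNF yt => /eqP ->.
have nxy : (x == y) = false by rewrite eq_sym.
have nzx : (z == x) = false by rewrite eq_sym (negPf nxz).
have xt' : x \in vars t' by rewrite vt' inE xt orbT.
have zt' : z \in vars t' by rewrite vt' inE zt orbT.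
have yt' : y \in vars t' by rewrite vt' inE eqxx.
have px : pos 1 t' x = pos 1 t x by rewrite pt'.
rewrite mem_cat (st _ _ _ sz) => /orP[] n_in.
  have [||u [w [lu dv pm]]] := IH1 (upd (upd s z v1) y v2) t' z _ lt' xt' zt' nxz.
  - by rewrite /upd nzy eqxx.
  - by rewrite px pz.
  exists u, (App w v2); split=> //.
    rewrite (st (upd (upd s x u) z (App w v2)) w v2) ?/upd ?eqxx //.
    rewrite [X in derivable _ _ X](_ : _ = subst (upd (upd (upd (upd s z v1) y v2) x u) z w) t') //.
    apply: eq_subst => a _; rewrite /upd.
    case: (eqVneq a y) => [->|//]; first by rewrite nyz nyx.
    by case: (eqVneq a z) => [->|//].
  move: pm; rewrite px pz /upd nxy (negPf nxz) /= => pm.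
  by rewrite (perm_cat_mid [:: _]) !catA perm_cat2r.
have [||u [w [lu dv pm]]] := IH2 (upd (upd s z v1) y v2) t' y _ lt' xt' yt' (negbT nxy).
- by rewrite /upd eqxx.
- by rewrite px py.
exists u, (App v1 w); split=> //.
  rewrite (st (upd (upd s x u) z (App v1 w)) v1 w) ?/upd ?eqxx //.
  rewrite [X in derivable _ _ X](_ : _ = subst (upd (upd (upd (upd s z v1) y v2) x u) y w) t') //.
  apply: eq_subst => a _; rewrite /upd.
  by case: (eqVneq a y) => // _; case: (eqVneq a z) => [->|//]; rewrite nzx.
move: pm; rewrite px py /upd nxy (negPf nxz) /= => pm.
by rewrite (perm_cat_mid [:: _]) perm_cat_mid.
Qed.

(** * Building one side into the other *)

Definition forest t (s : nat -> term) xs :=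
  flatten [seq nodes (pos 1 t x) (s x) | x <- xs].

Lemma eq_forest t t' s s' xs :
    {in xs, pos 1 t =1 pos 1 t'} -> (forall x, x \in xs -> s x = s' x) ->
  forest t s xs = forest t' s' xs.
Proof.
move=> pt ss; rewrite /forest; congr flatten; apply/eq_in_map => x xxs.
by rewrite pt // ss.
Qed.

(** Equality of the multisets provides a node with the position of [x] and the label wanted there.
    If the single leaf [s x] has another label, that node lies below some other [z] in [xs], so the
    subterms to exchange are disjoint. *)
Lemma forest_head t x xs s s' a : uniq (x :: xs) -> linear_term t ->
    {subset x :: xs <= vars t} -> s x = Var a ->
    perm_eq (forest t s (x :: xs)) (forest t s' (x :: xs)) ->
  exists s2,
    [/\ label (s2 x) = label (s' x), derivable laws (subst s t) (subst s2 t),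
        (forall z, z \notin x :: xs -> s2 z = s z) &
        perm_eq (forest t s2 (x :: xs)) (forest t s (x :: xs))].
Proof.
move=> /= /andP[nx uxs] lt sub sx pm.
have [eql|neql] := eqVneq (label (s x)) (label (s' x)).
  by exists s; split=> //; apply: der_refl.
have x_in : (pos 1 t x, label (s' x)) \in forest t s (x :: xs).
  by rewrite (perm_mem pm) /forest /= mem_cat; case: (s' x) => * /=; rewrite inE eqxx.
have nla : (label (s' x) == Some a) = false.
  by apply: contraNF neql => /eqP ->; rewrite sx.
rewrite /forest /= mem_cat sx inE xpair_eqE nla andbF /= in x_in.
have /flatten_mapP[z zxs n_in] := x_in.
have nxz : x != z by apply: contraNneq nx => ->.
have xt : x \in vars t by apply: sub; rewrite mem_head.
have zt : z \in vars t by apply: sub; rewrite inE zxs orbT.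
have [u [w [lu dv pmuw]]] := expose lt xt zt nxz n_in.
exists (upd (upd s x u) z w); split=> //.
- by rewrite /upd (negPf nxz) eqxx.
- move=> b; rewrite inE negb_or /upd => /andP[/negPf -> nb].
  by case: eqP zxs nb => // -> ->.
have pz := perm_to_rem zxs.
have pf r : perm_eq (forest t r (x :: xs)) (forest t r [:: x, z & rem z xs]).
  by apply/perm_flatten/perm_map; rewrite perm_cons.
rewrite (permPl (pf _)) (permPr (pf _)) /forest /= /upd (negPf nxz) !eqxx !catA.
apply: perm_cat => //.
rewrite -/(forest t _ _) -/(forest t s _) (@eq_forest t t _ s) // => b b_rem.
have nbz : (b == z) = false.
  by apply: contraTF b_rem => /eqP ->; rewrite mem_rem_uniqF.
rewrite nbz; case: eqP => // bx; move: nx; rewrite -bx.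
by rewrite (mem_rem b_rem).
Qed.

(* The leaves of [t] outside [xs] already carry equal subterms; the remaining
   ones are treated one at a time. *)
Lemma derivable_forest t xs s s' : linear_term t -> uniq xs ->
    {subset xs <= vars t} ->
    (forall z, z \in vars t -> z \notin xs -> s z = s' z) ->
    perm_eq (forest t s xs) (forest t s' xs) ->
  derivable laws (subst s t) (subst s' t).
Proof.
have [N] := ubnP (size (forest t s xs)).
elim: N t xs s s' => // N IHN t [|x xs] s s' ltN lt uxs sub eqs pm.
  by rewrite (@eq_subst s s') => [|z zt]; [apply: der_refl | apply: eqs].
have xt : x \in vars t by apply: sub; rewrite mem_head.
(* Once the roots at [x] agree, both forests lose one node: equal variables let [x] leave the list,
   and two products are split into their children. *)
have same r r' : (size (forest t r (x :: xs)) < N.+1)%N ->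
    (forall z, z \in vars t -> z \notin x :: xs -> r z = r' z) ->
    perm_eq (forest t r (x :: xs)) (forest t r' (x :: xs)) ->
    label (r x) = label (r' x) -> derivable laws (subst r t) (subst r' t).
  case rx: (r x) => [b|u v]; case r'x: (r' x) => [b'|u' v'] //= lr er pr lab.
    case: lab r'x => <- r'x; have /andP[nx u_xs] := uxs.
    apply: (IHN t xs) => //.
    - by move: lr; rewrite /forest /= rx.
    - by move=> z zxs; apply: sub; rewrite inE zxs orbT.
    - move=> z zt nz; case: (eqVneq z x) => [->|nzx]; first by rewrite rx r'x.
      by apply: er; rewrite // inE negb_or nzx.
    - by move: pr; rewrite /forest /= rx r'x perm_cons.
  have /andP[nx u_xs] := uxs.
  have [t' [y [[lt' yt vt'] [pt' px py st]]]] := split_leaf lt xt.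
  have nyx : (y == x) = false by apply: contraNF yt => /eqP ->.
  have xst z : z \in xs -> z \in vars t by move=> zxs; apply: sub; rewrite inE zxs orbT.
  have ny : y \notin xs by apply: contra yt; apply: xst.
  have forestE (f : nat -> term) c d : f x = App c d ->
      forest t f (x :: xs) =
      (pos 1 t x, None) :: forest t' (upd (upd f x c) y d) [:: x, y & xs].
    move=> fx; rewrite {1}/forest /= fx /forest /= px py {1 2}/upd eq_sym nyx !eqxx.
    rewrite /upd eqxx catA; congr (_ :: (_ ++ _)).
    rewrite -/(forest t f xs) -/(forest t' _ xs).
    apply: eq_forest => z zxs.
      by rewrite pt' ?xst //; apply: contraNneq nx => <-.
    by case: eqP ny => [<-|_]; rewrite ?zxs // => _; case: eqP nx => // <-; rewrite zxs.
  rewrite (st _ _ _ rx) (st _ _ _ r'x).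
  move: lr pr; rewrite (forestE _ _ _ rx) (forestE _ _ _ r'x) perm_cons => lr pr.
  apply: (IHN t' [:: x, y & xs]) => //.
  - by rewrite !cons_uniq inE eq_sym nyx nx ny.
  - by move=> z; rewrite vt' !inE => /or3P[/eqP->|->|/xst->]; rewrite ?xt ?orbT.
  - move=> z; rewrite vt' !inE !negb_or => /orP[/eqP->|zt]; first by rewrite eqxx andbF.
    case/and3P=> zx zy nz; rewrite /upd (negPf zx) (negPf zy).
    by apply: er; rewrite // inE negb_or zx.
have var r r' b : r x = Var b -> (size (forest t r (x :: xs)) < N.+1)%N ->
    (forall z, z \in vars t -> z \notin x :: xs -> r z = r' z) ->
    perm_eq (forest t r (x :: xs)) (forest t r' (x :: xs)) ->
    derivable laws (subst r t) (subst r' t).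
  move=> rx lr er pr; have [r2 [lab dv er2 pr2]] := forest_head uxs lt sub rx pr.
  apply: der_trans dv _; apply: same lab.
  - by rewrite (perm_size pr2).
  - by move=> z zt nz; rewrite er2 // er.
  - exact: perm_trans pr2 pr.
case sx: (s x) => [b|u v]; first exact: var sx _ _ _.
case s'x: (s' x) => [b|u' v']; last by apply: same; rewrite ?sx ?s'x.
(* The variable is now on the side of [s'], so the two sides exchange roles. *)
apply/der_sym/(var _ _ _ s'x).
- by rewrite -(perm_size pm).
- by move=> z zt nz; rewrite eqs.
- by rewrite perm_sym.
Qed.

Lemma perm_derivable p q : perm_eq (nodes 1 p) (nodes 1 q) -> derivable laws p q.
Proof.
(* The context is a single leaf, carrying the whole terms. *)
move=> pq; apply: (@derivable_forest (Var 0) [:: 0%N] (fun=> p) (fun=> q)) => //.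
  by move=> z ->.
by rewrite /forest /= !cats0.
Qed.

End Nodes.

(** * Elements of the group ring as differences of interior counts *)

Section Realization.

Variables (gT : finGroupType) (alpha beta : gT).
Hypothesis gen_ab : <<[set alpha; beta]>>%g = [set: gT].
Local Open Scope ring_scope.

Definition interior (t : term) (k : gT) : int :=
  (count_mem (k, None) (nodes alpha beta 1%g t))%:Z.

Lemma count_mem_nodes_mulg g h t k l :
  count_mem ((g * k)%g, l) (nodes alpha beta (g * h)%g t)
  = count_mem (k, l) (nodes alpha beta h t).
Proof.
rewrite nodes_mulg count_map; apply: eq_count => -[k' l'] /=.
by rewrite !xpair_eqE (inj_eq (mulgI g)).
Qed.

Lemma count_leaf_interior t k :
  (count (leaf_at k) (nodes alpha beta 1%g t))%:Z =
  (k == 1%g)%:Z + interior t (k * alpha^-1)%g + interior t (k * beta^-1)%g - interior t k.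
Proof. by rewrite /interior -!PoszD -count_nodes PoszD addrK. Qed.

Lemma interior_App p q k :
  interior (App p q) k =
  (k == 1%g)%:Z + interior p (alpha^-1 * k)%g + interior q (beta^-1 * k)%g.
Proof.
rewrite /interior /= count_cat /= xpair_eqE andbT eq_sym !PoszD addrA.
by rewrite -(count_mem_nodes_mulg alpha 1%g p) -(count_mem_nodes_mulg beta 1%g q)
   !mulKVg !mulg1 !mul1g.
Qed.

(* The differences of interior counts form an ideal of Z[G] containing 1. *)
Definition realizable (d : gT -> int) : Prop :=
  exists p q, forall k, interior p k - interior q k = d k.

Lemma eq_realizable d d' : d =1 d' -> realizable d -> realizable d'.
Proof. by move=> dd [p [q pq]]; exists p, q => k; rewrite pq. Qed.

Lemma realizable0 : realizable (fun=> 0).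
Proof. by exists (Var 0), (Var 0) => k; rewrite subrr. Qed.

(** By nu(pq) = 1 + alpha nu(p) + beta nu(q), the constant 1 cancels in differences. *)
Lemma realizable_App d e : realizable d -> realizable e ->
  realizable (fun k => d (alpha^-1 * k)%g + e (beta^-1 * k)%g).
Proof.
move=> [p [q pq]] [p' [q' pq']]; exists (App p p'), (App q q') => k.
by rewrite !interior_App -pq -pq'; ring.
Qed.

(** In a finite group generation needs no inverses: [g] is a word in [alpha] and [beta], and each
    letter is realized by a product whose other factor has difference 0. *)
Lemma realizable_mulg g d : realizable d -> realizable (fun k => d (g^-1 * k)%g).
Proof.
have : g \in <<[set alpha; beta]>>%g by rewrite gen_ab inE.
case/gen_prodgP => n [c c_ab ->] {g}.
elim: n c c_ab d => [|n IHn] c c_ab d rd.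
  by apply: eq_realizable rd => k; rewrite big_ord0 invg1 mul1g.
rewrite big_ord_recl; set h := (\prod_(i < n) _)%g.
have rh : realizable (fun k => d (h^-1 * k)%g).
  by apply: IHn => // i; apply: c_ab.
have /set2P[->|->] := c_ab ord0.
  apply: eq_realizable (realizable_App rh realizable0) => k.
  by rewrite addr0 invMg mulgA.
apply: eq_realizable (realizable_App realizable0 rh) => k.
by rewrite add0r invMg mulgA.
Qed.

(** A product translates its factors by [alpha] and [beta] before adding; translating beforehand by
    the inverses compensates for this. *)
Lemma realizableD d e : realizable d -> realizable e ->
  realizable (fun k => d k + e k).
Proof.
move=> /(realizable_mulg alpha^-1) rd /(realizable_mulg beta^-1) re.
by apply: eq_realizable (realizable_App rd re) => k; rewrite !invgK !mulKVg.
Qed.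

Lemma realizableN d : realizable d -> realizable (fun k => - d k).
Proof. by move=> [p [q pq]]; exists q, p => k; rewrite -pq opprB. Qed.

Lemma realizable_point g (z : int) : realizable (fun k => z * (k == g)%:Z).
Proof.
have r1 : realizable (fun k => (k == g)%:Z).
  suff /(realizable_mulg g) : realizable (fun k => (k == 1%g)%:Z).
    by apply: eq_realizable => k; rewrite -eq_mulVg1 eq_sym.
  (* One product against a bare variable: a single interior node, at the root. *)
  exists (App (Var 0) (Var 0)), (Var 0) => k.
  have i0 h : interior (Var 0) h = 0 by rewrite /interior /= xpair_eqE andbF.
  by rewrite interior_App !i0 subr0 !addr0.
case: (intP z) => [|n|n].
- by apply: eq_realizable realizable0 => k; rewrite mul0r.
- elim: n.+1 => [|{}n IHn].
    by apply: eq_realizable realizable0 => k; rewrite mul0r.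
  by apply: eq_realizable (realizableD r1 IHn) => k; rewrite intS mulrDl mul1r.
- elim: n.+1 => [|{}n IHn].
    by apply: eq_realizable realizable0 => k; rewrite oppr0 mul0r.
  apply: eq_realizable (realizableD (realizableN r1) IHn) => k.
  by rewrite intS opprD mulrDl mulN1r.
Qed.

Lemma realizableT d : realizable d.
Proof.
apply: (@eq_realizable (fun k => \sum_(g : gT) d g * (k == g)%:Z)).
  move=> k; rewrite (bigD1 k) //= eqxx mulr1 big1 ?addr0 // => g.
  by rewrite eq_sym => /negPf ->; rewrite mulr0.
elim: (index_enum gT) => [|g r IHr].
  by apply: eq_realizable realizable0 => k; rewrite big_nil.
by apply: eq_realizable (realizableD (realizable_point g (d g)) IHr) => k; rewrite big_cons.
Qed.

Lemma interior_subst0 t k : interior (subst (fun=> Var 0) t) k = interior t k.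
Proof.
rewrite /interior nodes_subst; congr Posz.
elim: (nodes _ _ _ t) => //= -[h [x|]] s IHs /=; last by rewrite IHs.
by rewrite IHs !xpair_eqE !andbF.
Qed.

(** With all variables identified, it is enough that both sides have equally many leaves at each
    position. By [count_leaf_interior] this holds when alpha + beta - 1 kills nu(p) - nu(q). *)
Lemma Sigma_subst0 p q :
    (forall k, interior p k - interior q k =
       (interior p (k * alpha^-1)%g - interior q (k * alpha^-1)%g)
       + (interior p (k * beta^-1)%g - interior q (k * beta^-1)%g)) ->
  Sigma alpha beta (subst (fun=> Var 0) p, subst (fun=> Var 0) q).
Proof.
pose leaves t := [seq n.1 | n <- nodes alpha beta 1%g t & n.2 != None].
move=> pq v; apply/ffunP => k; rewrite -[k]mul1g -[X in (X * k)%g]invg1.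
have E t : geval alpha beta v (subst (fun=> Var 0) t) (1^-1 * k)%g =
    \sum_(h <- leaves t) v 0%N (h^-1 * k)%g.
  rewrite geval_nodes big_map big_filter nodes_subst big_flatten /= big_map.
  by rewrite [RHS]big_mkcond; apply: eq_bigr => -[h [x|]] _ /=; apply: big_seq1.
rewrite !E; apply: perm_big; apply/allP => {v E}k _ /=.
have leavesE t : count_mem k (leaves t) = count (leaf_at k) (nodes alpha beta 1%g t).
  by rewrite count_map count_filter.
by rewrite !leavesE -eqz_nat !count_leaf_interior; have := pq k; lia.
Qed.

End Realization.

(** * Characters of a product of two cyclic groups *)

Section Characters.

Variables (gT : finGroupType) (delta eps : gT).
Hypothesis dprodT : (<[delta]> \x <[eps]>)%g = [set: gT].

Lemma dprod_cycle_coords g : exists ij : nat * nat, g = (delta ^+ ij.1 * eps ^+ ij.2)%g.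
Proof.
have [_ defT _ _] := dprodP dprodT.
have : g \in (<[delta]> * <[eps]>)%g by rewrite defT inE.
by case/mulsgP => x y /cycleP[i ->] /cycleP[j ->] ->; exists (i, j).
Qed.

Lemma dprod_cycle_inj i j k l :
    (delta ^+ i * eps ^+ j = delta ^+ k * eps ^+ l)%g ->
  i = k %[mod #[delta]%g] /\ j = l %[mod #[eps]%g].
Proof.
have [_ _ _ tI] := dprodP dprodT => E.
(* This element lies in both cyclic factors, hence is trivial. *)
have F : (delta ^- k * delta ^+ i = eps ^+ l * eps ^- j)%g.
  by apply: (mulIg (eps ^+ j)%g); rewrite mulgKV -mulgA E mulKg.
have F1 : (delta ^- k * delta ^+ i = 1)%g.
  apply/set1gP; rewrite -tI inE {2}F.
  by rewrite !groupM ?groupV ?groupX ?cycle_id.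
split; apply/eqP; rewrite -eq_expg_mod_order.
  by rewrite eq_sym eq_mulVg1 F1.
by rewrite eq_sym eq_mulgV1 -F F1.
Qed.

Lemma dprod_cycleM i j k l :
  (delta ^+ i * eps ^+ j * (delta ^+ k * eps ^+ l) =
   delta ^+ (i + k) * eps ^+ (j + l))%g.
Proof.
have [_ _ cDE _] := dprodP dprodT.
have ce : commute (eps ^+ j)%g (delta ^+ k)%g.
  by apply/commuteX2; apply: (centP (subsetP cDE _ (cycle_id _))); apply: cycle_id.
by rewrite !expgD !mulgA; congr (_ * _)%g; rewrite -!mulgA ce.
Qed.

Local Open Scope ring_scope.

(** Exponents are chosen for each element; the choice does not matter, since they are unique modulo
    the orders, at which the powers of [omega] and [xi] are 1. *)
Lemma dprod_char (omega xi : algC) :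
    omega ^+ #[delta]%g = 1 -> xi ^+ #[eps]%g = 1 ->
  exists chi : gT -> algC,
    (forall i j, chi (delta ^+ i * eps ^+ j)%g = omega ^+ i * xi ^+ j) /\
    (forall g i j, chi (g * (delta ^+ i * eps ^+ j))%g = chi g * (omega ^+ i * xi ^+ j)).
Proof.
move=> om1 xi1; have [f f_def] := fin_all_exists dprod_cycle_coords.
pose chi g := omega ^+ (f g).1 * xi ^+ (f g).2.
have chiE i j : chi (delta ^+ i * eps ^+ j)%g = omega ^+ i * xi ^+ j.
  have [ei ej] := dprod_cycle_inj (f_def (delta ^+ i * eps ^+ j)%g).
  by rewrite /chi -(expr_mod _ om1) -ei (expr_mod _ om1) -(expr_mod _ xi1) -ej (expr_mod _ xi1).
exists chi; split=> // g i j.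
by rewrite {1}(f_def g) dprod_cycleM chiE /chi !exprD; ring.
Qed.

(** A polynomial of degree below [n] that vanishes at the [n] distinct powers of a primitive root is
    zero. *)
Lemma roots_of_unity_coef_eq0 n (c : 'I_n -> algC) : (0 < n)%N ->
    (forall z, z ^+ n = 1 -> \sum_(i < n) c i * z ^+ i = 0) ->
  forall i, c i = 0.
Proof.
move=> n_gt0 c0; have [z prim_z] := C_prim_root_exists n_gt0.
pose p := \poly_(i < n) (if insub i is Some j then c j else 0).
have pE x : p.[x] = \sum_(i < n) c i * x ^+ i.
  by rewrite horner_poly; apply: eq_bigr => i _; rewrite valK.
have p0 : p = 0.
  apply/eqP; apply: contraT => pn0.
  have := @max_poly_roots _ p [seq z ^+ (i : 'I_n) | i : 'I_n] pn0.
  rewrite size_map -cardE card_ord => /(_ _ _)/leq_trans/(_ (size_poly _ _)).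
  rewrite ltnn; apply.
    apply/allP => _ /mapP[i _ ->]; rewrite rootE pE c0 //.
    by rewrite -exprM mulnC exprM (prim_expr_order prim_z) expr1n.
  rewrite map_inj_uniq ?enum_uniq // => i j /eqP.
  by rewrite (eq_prim_root_expr prim_z) !modn_small // => /eqP/val_inj.
move=> i; have := congr1 (fun q : {poly algC} => q`_i) p0.
by rewrite coef_poly coef0 ltn_ord valK.
Qed.

(** Injectivity of the Fourier transform: the one-variable statement applies to the exponent of
    [delta] for fixed [xi], then to that of [eps]. *)
Lemma fourier_eq0 (d : gT -> algC) :
    (forall omega xi : algC, omega ^+ #[delta]%g = 1 -> xi ^+ #[eps]%g = 1 ->
      forall chi : gT -> algC,
        (forall i j, chi (delta ^+ i * eps ^+ j)%g = omega ^+ i * xi ^+ j) ->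
      \sum_k d k * chi k = 0) ->
  forall k, d k = 0.
Proof.
move=> d0; set m := #[delta]%g in d0 *; set n := #[eps]%g in d0 *.
pose h (ij : 'I_m * 'I_n) := (delta ^+ ij.1 * eps ^+ ij.2)%g.
have bij_h : bijective h.
  apply: inj_card_bij => [[i j] [k l] /dprod_cycle_inj[]|].
    by rewrite /= !modn_small // => /val_inj-> /val_inj->.
  by rewrite card_prod !card_ord -cardsT -(dprod_card dprodT).
have dh0 i j : d (h (i, j)) = 0.
  apply: (@roots_of_unity_coef_eq0 n (fun j => d (h (i, j)))) => [|xi xi1].
    exact: order_gt0.
  apply: (@roots_of_unity_coef_eq0 m (fun i => \sum_j d (h (i, j)) * xi ^+ j)) => [|om om1].
    exact: order_gt0.
  have [chi [chiE _]] := dprod_char om1 xi1.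
  rewrite -[RHS](d0 _ _ om1 xi1 _ chiE) (reindex h) /=; last exact: onW_bij.
  under eq_bigr do rewrite mulr_suml.
  rewrite pair_bigA /=; apply: eq_bigr => -[i' j'] _ /=.
  by rewrite chiE; ring.
by case: bij_h => h' _ h'K k; rewrite -(h'K k); case: (h' k).
Qed.

(** * Zero divisors and vanishing characters *)

Variables a a' b b' : nat.
Let alpha := (delta ^+ a * eps ^+ a')%g.
Let beta := (delta ^+ b * eps ^+ b')%g.

(** The Fourier coefficient S of [d] at a character chi satisfies S = S (chi(alpha) + chi(beta)), so
    the nonvanishing condition forces S = 0. *)
Lemma kernel_eq0 (d : gT -> int) :
    (forall omega xi : algC, omega ^+ #[delta]%g = 1 -> xi ^+ #[eps]%g = 1 ->
      -1 + omega ^+ a * xi ^+ a' + omega ^+ b * xi ^+ b' != 0) ->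
    (forall k, d k = d (k * alpha^-1)%g + d (k * beta^-1)%g) ->
  forall k, d k = 0.
Proof.
move=> nz dE k; apply: (intr_inj (R := algC)).
apply: (fourier_eq0 (d := fun k => (d k)%:~R)) => {k} om xi om1 xi1 chi chiE.
(* Only the values of [chi] are given; comparison with [chi'] shows that it is multiplicative. *)
have [chi' [chi'E chiM]] := dprod_char om1 xi1.
have {chi'E} chiM g i j :
    chi (g * (delta ^+ i * eps ^+ j))%g = chi g * (om ^+ i * xi ^+ j).
  have chi_eq k : chi k = chi' k.
    by have [[u v] ->] := dprod_cycle_coords k; rewrite chiE chi'E.
  by rewrite !chi_eq chiM.
set S := \sum_k _.
have shift i j : \sum_k (d (k * (delta ^+ i * eps ^+ j)^-1)%g)%:~R * chi k
               = S * (om ^+ i * xi ^+ j).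
  rewrite (reindex_inj (mulIg (delta ^+ i * eps ^+ j)%g)) mulr_suml.
  by apply: eq_bigr => k _; rewrite mulgK chiM !mulrA.
have SE : S = S * (om ^+ a * xi ^+ a') + S * (om ^+ b * xi ^+ b').
  rewrite -!shift -big_split; apply: eq_bigr => k _ /=.
  by rewrite dE rmorphD mulrDl.
apply/eqP; move: (nz _ _ om1 xi1); apply: contraNT => Sn0.
by apply/eqP/(mulfI Sn0); rewrite mulr0 !mulrDr mulrN1 -addrA -SE addNr.
Qed.

(* The relation says that [d] is annihilated by an integer matrix; the inverse
   of the bad character shows that this matrix is singular. *)
Lemma kernel_exists (omega xi : algC) :
    omega ^+ #[delta]%g = 1 -> xi ^+ #[eps]%g = 1 ->
    -1 + omega ^+ a * xi ^+ a' + omega ^+ b * xi ^+ b' = 0 ->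
  exists2 d : gT -> int, (exists k, d k != 0) &
    forall k, d k = d (k * alpha^-1)%g + d (k * beta^-1)%g.
Proof.
move=> om1 xi1 bad.
have [chi [chiE chiM]] := dprod_char om1 xi1.
pose e (i : 'I_#|gT|) : gT := enum_val i.
(* In coordinates, multiplication of a row vector by alpha + beta - 1. *)
pose M : 'M[int]_#|gT| := \matrix_(i, j)
  ((e i == e j * alpha^-1)%g%:Z + (e i == e j * beta^-1)%g%:Z - (e i == e j)%:Z).
(* The general ring serves both the complex character and the integral kernel vector. *)
have mulM (R : comNzRingType) (v : gT -> R) j :
    ((\row_i v (e i)) *m map_mx intr M) 0 j =
    v (e j * alpha^-1)%g + v (e j * beta^-1)%g - v (e j).
  have pick k : \sum_i v (e i) * ((e i == k)%:Z)%:~R = v k.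
    rewrite (bigD1 (enum_rank k)) //= /e enum_rankK eqxx mulr1 big1 ?addr0 // => i ni.
    case: eqP => [ik|_]; last by rewrite mulr0.
    by move: ni; rewrite -ik enum_valK eqxx.
  rewrite mxE -[X in _ = X + _ - _]pick -[X in _ = _ + X - _]pick.
  rewrite -[X in _ = _ - X]pick -big_split -sumrB; apply: eq_bigr => i _ /=.
  by rewrite !mxE rmorphB rmorphD mulrBr mulrDr.
have om0 : omega != 0.
  by apply: contraTneq isT => o0; move/eqP: om1; rewrite o0 expr0n eqn0Ngt order_gt0 eq_sym oner_eq0.
have xi0 : xi != 0.
  by apply: contraTneq isT => o0; move/eqP: xi1; rewrite o0 expr0n eqn0Ngt order_gt0 eq_sym oner_eq0.
have /det0P[v v0 vM] : \det M == 0.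
  rewrite -(intr_eq0 algC) -det_map_mx; apply/det0P.
  (* Translating the argument by [alpha^-1] multiplies the inverse character by chi(alpha), so every
     entry of the product has the factor chi(alpha) + chi(beta) - 1 = 0. *)
  exists (\row_i (chi (e i))^-1).
    apply/eqP => /rowP/(_ (enum_rank 1%g)); rewrite !mxE /e enum_rankK => /eqP.
    by rewrite invr_eq0 -[1%g]mulg1 (chiE 0%N 0%N) mulr1 oner_eq0.
  apply/rowP => j; rewrite (mulM _ (fun g => (chi g)^-1)) mxE.
  have chiV i k g : (chi (g * (delta ^+ i * eps ^+ k)^-1)%g)^-1 =
      (chi g)^-1 * (omega ^+ i * xi ^+ k).
    rewrite -{2}[g](mulgKV (delta ^+ i * eps ^+ k)%g) chiM invfM mulfVK //.
    by rewrite mulf_neq0 // expf_neq0.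
  rewrite !chiV -mulrDr -[X in _ - X]mulr1 -mulrBr.
  by rewrite [X in _ * X](_ : _ = 0) ?mulr0 // -[RHS]bad; ring.
exists (fun k => v 0 (enum_rank k)).
  have /rV0Pn[i vi] := v0.
  by exists (enum_val i); rewrite enum_valK.
move=> k; have := mulM _ (fun k => v 0 (enum_rank k)) (enum_rank k).
rewrite (_ : \row_i _ = v); last by apply/rowP => i; rewrite mxE /e enum_valK.
rewrite (_ : map_mx _ M = M); last by apply/matrixP => i j; rewrite mxE intz.
by rewrite vM mxE /e enum_rankK => /eqP; rewrite eq_sym subr_eq0 => /eqP.
Qed.

End Characters.

Theorem theorem9p1 (gT : finGroupType) (delta eps : gT) (m n a a' b b' : nat) :
  #[delta]%g = m -> #[eps]%g = n ->
  (<[delta]> \x <[eps]>)%g = [set: gT] ->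
  let alpha := (delta ^+ a * eps ^+ a')%g in
  let beta := (delta ^+ b * eps ^+ b')%g in
  <<[set alpha; beta]>>%g = [set: gT] ->
  (is_basis (fun e => interchange_law e /\ Sigma alpha beta e) (Sigma alpha beta)
   <->
   (forall omega xi : algC, omega ^+ m = 1 -> xi ^+ n = 1 ->
      -1 + omega ^+ a * xi ^+ a' + omega ^+ b * xi ^+ b' != 0)%R).
Proof.
move=> <- <- dpT alpha beta gen_ab; split=> [basis omega xi om1 xi1|nz p q].
  apply/negP => /eqP bad.
  have [d [k dk0] dE] := kernel_exists dpT om1 xi1 bad.
  have [p [q pq]] := realizableT gen_ab d.
  (* Lying in [Sigma], this identity would be derivable, forcing equal interior counts at [k],
     against [dk0]. *)
  have /basis/derivable_perm/seq.permP/(_ (pred1 (k, None))) E :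
      Sigma alpha beta (subst (fun=> Var 0) p, subst (fun=> Var 0) q).
    by apply: Sigma_subst0 => h; rewrite !pq.
  move: dk0; rewrite -pq -(interior_subst0 _ _ p) -(interior_subst0 _ _ q).
  by rewrite /interior E subrr eqxx.
split=> [/derivable_perm/perm_nodes_Sigma //|pq].
apply: perm_derivable.
(* Equal leaf counts mean that alpha + beta - 1 kills this difference, which is therefore 0. *)
have d0 := kernel_eq0 dpT (d := fun k => interior alpha beta p k - interior alpha beta q k)%R nz.
apply/allP => -[k [x|]] _ /=; apply/eqP; first exact: Sigma_count_var.
apply/eqP; rewrite -eqz_nat -subr_eq0; apply/eqP; apply: d0 => {}k.
have := congr1 Posz (Sigma_count_leaf k pq); rewrite !count_leaf_interior -/alpha -/beta; lia.
Qed.
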